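(* Let $\mu$ be a stationary, ergodic cocycle measure on $\mathbb{Z}^2$ with $0<h,v<1$, and let $\epsilon>0$. Then with $\mu$-probability one, only finitely many points $z\in\mathbb{Z}^2$ outside $C_0(\epsilon)$ satisfy $f(z)=0$.
   Context: Label the nearest-neighbour edges of $\mathbb{Z}^2$ with $0$ or $1$; configurations live in $\{0,1\}^E$, $E$ being the edge set, with the product $\sigma$-field. For a vertex-self-avoiding path $\pi$ from $x$ to $y$, let $\pi^+$ be the set of its edges travelled to the right or upwards, and $\pi^-$ the set of its edges travelled to the left or downwards. A configuration has the cocycle property if for all vertices $x,y$ both (number of edges labelled $1$ in $\pi^+$ minus number labelled $1$ in $\pi^-$) and (number of edges labelled $0$ in $\pi^+$ minus number labelled $0$ in $\pi^-$) are the same for all such paths $\pi$ from $x$ to $y$. Equivalently, on every unit square: label(bottom) + label(right) = label(left) + label(top). A cocycle measure is a probability measure $\mu$ on $\{0,1\}^E$ concentrated on configurations with the cocycle property. Stationary means invariant under all translations of $\mathbb{Z}^2$; ergodic means ergodic with respect to the group of all translations of $\mathbb{Z}^2$. $h$ is the expectation under $\mu$ of the label of a horizontal edge, $v$ the expectation of the label of a vertical edge; it is assumed that $0<h,v<1$. For $z\in\mathbb{Z}^2$, $f(z)$ is the sum of the labels in $\pi^+$ minus the sum of the labels in $\pi^-$, where $\pi$ is any self-avoiding path from $0$ to $z$. With $\alpha_0=-h/v$, $C_0(\epsilon)=\{(x,y)\in\mathbb{Z}^2: \alpha_0-\epsilon\le y/x\le\alpha_0+\epsilon\}$ (points with $x=0$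 are not in $C_0(\epsilon)$). *)

(* Defs.v *)
From mathcomp Require Import all_boot all_order all_algebra.
From mathcomp Require Import all_classical all_reals all_analysis.

Set Implicit Arguments.
Unset Strict Implicit.
Unset Printing Implicit Defensive.
Import Order.TTheory GRing.Theory Num.Theory.
Local Open Scope classical_set_scope.
Local Open Scope ring_scope.

Definition vertex := (int * int)%type.

(* An edge is its left (resp. lower) endpoint, tagged [false] if the edge is
   horizontal and [true] if it is vertical. *)
Definition edge := (vertex * bool)%type.
Definition hedge (z : vertex) : edge := (z, false).
Definition vedge (z : vertex) : edge := (z, true).

(* [true] is the label 1, [false] the label 0. *)
Definition cylinders : set (set (edge -> bool)) :=
  \bigcup_(e in [set: edge])
    preimage_set_system setT (fun w : edge -> bool => w e) measurable.

(* {0,1}^E with the product sigma-algebra. *)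
Definition config := g_sigma_algebraType cylinders.

Definition label (w : config) (e : edge) : bool := w e.

(* The edge travelled by a step from [a] to [b], if that step goes to the right
   or upwards. *)
Definition fwd_edge (a b : vertex) : option edge :=
  if b == a + ((1, 0) : vertex) then Some (hedge a)
  else if b == a + ((0, 1) : vertex) then Some (vedge a)
  else None.

Definition adjacent : rel vertex :=
  fun a b => isSome (fwd_edge a b) || isSome (fwd_edge b a).

(* The path visits the vertices [x :: p] in this order. *)
Definition sapath (x y : vertex) (p : seq vertex) : bool :=
  [&& path adjacent x p, uniq (x :: p) & last x p == y].

(* pi^+ and pi^-. For a self-avoiding path these lists have no repetitions, so
   counting in them is counting in the corresponding sets. *)
Definition pos_edges (x : vertex) (p : seq vertex) : seq edge :=
  pmap (fun s => fwd_edge s.1 s.2) (zip (x :: p) p).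
Definition neg_edges (x : vertex) (p : seq vertex) : seq edge :=
  pmap (fun s => fwd_edge s.2 s.1) (zip (x :: p) p).

Definition signed_count (w : config) (b : bool) (x : vertex) (p : seq vertex) :
    int :=
  (count (fun e => label w e == b) (pos_edges x p))%:Z
  - (count (fun e => label w e == b) (neg_edges x p))%:Z.

Definition cocycle_property (w : config) : Prop :=
  forall (x y : vertex) (p q : seq vertex), sapath x y p -> sapath x y q ->
  signed_count w true x p = signed_count w true x q /\
  signed_count w false x p = signed_count w false x q.

Definition label_sum (w : config) (x : vertex) (p : seq vertex) : int :=
  \sum_(e <- pos_edges x p) (label w e : nat)%:Z
  - \sum_(e <- neg_edges x p) (label w e : nat)%:Z.

(* f(z), computed along a self-avoiding path from 0 to z that does not depend on
   the configuration; the default [::] of [xget] is not reached, see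
   [sapath_exists]. Under the cocycle property every path gives the same value, see
   [heightE]. *)
Definition height (w : config) (z : vertex) : int :=
  label_sum w 0 (xget [::] [set p | sapath 0 z p]).

Lemma sapath_exists (z : vertex) : exists p, sapath 0 z p.
Proof.
have step_r a b y p : path adjacent a p -> last a p = b -> adjacent b y ->
    exists2 q, path adjacent a q & last a q = y.
  move=> ap <- by'; exists (rcons p y); last by rewrite last_rcons.
  by rewrite rcons_path ap.
have adjC a b : adjacent a b = adjacent b a by rewrite /adjacent orbC.
have adjh a : adjacent a (a + (1, 0)).
  by rewrite /adjacent /fwd_edge eqxx.
have adjv a : adjacent a (a + (0, 1)).
  by rewrite /adjacent /fwd_edge eqxx; case: ifP.
have [p zp lp] : exists2 p, path adjacent (0 : vertex) p & last (0 : vertex) p = z.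
  case: z => x y; elim/int_rect: y => [|n [p ap lp]|n [p ap lp]].
  - elim/int_rect: x => [|n [p ap lp]|n [p ap lp]]; first by exists [::].
    + apply: step_r ap lp _.
      have -> : (n.+1%:Z, 0) = (n%:Z, 0) + ((1, 0) : vertex).
        by congr (_, _); rewrite -addn1 PoszD.
      exact: adjh.
    + apply: step_r ap lp _; rewrite adjC.
      have -> : (- n%:Z, 0) = (- n.+1%:Z, 0) + ((1, 0) : vertex).
        by congr (_, _); rewrite -addn1 PoszD opprD addrNK.
      exact: adjh.
  - apply: step_r ap lp _.
    have -> : (x, n.+1%:Z) = (x, n%:Z) + ((0, 1) : vertex).
      by congr (_, _); rewrite /= ?addr0// -addn1 PoszD.
    exact: adjv.
  - apply: step_r ap lp _; rewrite adjC.
    have -> : (x, - n%:Z) = (x, - n.+1%:Z) + ((0, 1) : vertex).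
      by congr (_, _); rewrite /= ?addr0// -addn1 PoszD opprD addrNK.
    exact: adjv.
move: lp; case: (shortenP zp) => q zq uq _ lq.
by exists q; rewrite /sapath zq uq lq eqxx.
Qed.

Lemma label_sumE (w : config) (x : vertex) (p : seq vertex) :
  label_sum w x p = signed_count w true x p.
Proof.
have sumE (s : seq edge) : \sum_(e <- s) (label w e : nat)%:Z
    = (count (fun e => label w e == true) s)%:Z.
  elim: s => [|e s IHs]; first by rewrite big_nil.
  by rewrite big_cons IHs /= eqb_id PoszD.
by rewrite /label_sum /signed_count !sumE.
Qed.

Lemma heightE (w : config) (z : vertex) (p : seq vertex) :
  cocycle_property w -> sapath 0 z p -> height w z = label_sum w 0 p.
Proof.
move=> cw zp; rewrite /height !label_sumE.
have zq : sapath 0 z (xget [::] [set p | sapath 0 z p]).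
  by apply: (@xgetPex _ [::] [set p | sapath 0 z p]); exists p.
by have [-> _] := cw _ _ _ _ zq zp.
Qed.

Definition translate (a : vertex) (w : config) : config :=
  fun e => w (e.1 + a, e.2).

Section CocycleMeasures.
Variable R : realType.
Implicit Type mu : probability config R.

Definition cocycle_measure mu : Prop := {ae mu, forall w, cocycle_property w}.

Definition stationary mu : Prop :=
  forall (a : vertex) (A : set config), measurable A ->
  mu (translate a @^-1` A) = mu A.

Definition ergodic mu : Prop :=
  forall A : set config, measurable A ->
  (forall a : vertex, translate a @^-1` A = A) ->
  mu A = 0%E \/ mu A = 1%E.

(* h and v, taken at the edges issued from the origin: for a stationary measure
   the edge is irrelevant. [fine] is harmless since labels are bounded. *)
Definition mean_h mu : R := fine 'E_mu[fun w => (label w (hedge 0))%:R].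
Definition mean_v mu : R := fine 'E_mu[fun w => (label w (vedge 0))%:R].

Definition alpha0 mu : R := - mean_h mu / mean_v mu.

Definition C0 mu (eps : R) : set vertex :=
  [set z | z.1 != 0 /\
     alpha0 mu - eps <= z.2%:~R / z.1%:~R <= alpha0 mu + eps].

End CocycleMeasures.

(* Main.v *)
Require Import Defs.
From mathcomp Require Import all_boot all_order all_algebra.
From mathcomp Require Import all_classical all_reals all_analysis.
From mathcomp Require Import measurable_realfun.
From mathcomp Require Import ring lra zify.

Import Order.TTheory GRing.Theory Num.Theory.
Import numFieldNormedType.Exports.
Local Open Scope classical_set_scope.
Local Open Scope ring_scope.

(* On the cocycle property, [f] is 1-Lipschitz and
   f(n z0) is the n-th Birkhoff sum of f(z0) under translation by [z0].
   The limsup of f(n z0)/n is invariant under all translations of Z^2, because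
   translating by [c] changes f(n z0) by at most 2|c|; hence it is a constant,
   even though translation by [z0] alone need not be ergodic.  Garsia's maximal
   inequality bounds that constant by E f(z0) = L(z0), where
   L(x, y) = h x + v y, and -f gives the matching lower bound.  Every [z] is
   within O(|z|/K) of a multiple of one of finitely many [z0], so that
   f(z) = L(z) + o(|z|) uniformly in the direction, whereas |L(z)| is bounded
   below by a multiple of |z| outside C_0(eps). *)

(** * The maximal ergodic inequality *)

Section MaximalErgodic.
Context d (T : measurableType d) (R : realType) (P : probability T R).

Lemma bounded_integrable (f : T -> R) (B : R) : measurable_fun setT f ->
  (forall x, `|f x| <= B) -> P.-integrable setT (EFin \o f).
Proof.
move=> mf fB; apply: measurable_bounded_integrable => //.
  by rewrite -ge0_fin_numE// fin_num_measure.
exists B; split; first exact: num_real.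
by move=> r Br x _ /=; exact: le_trans (fB x) (ltW Br).
Qed.

Lemma ae_eq_Rintegral (f g : T -> R) :
  measurable_fun setT f -> measurable_fun setT g ->
  {ae P, forall x, f x = g x} -> \int[P]_x f x = \int[P]_x g x.
Proof.
move=> mf mg fg; congr fine; apply: ae_eq_integral => //.
- exact/measurable_EFinP.
- exact/measurable_EFinP.
- by apply: filterS fg => x /= -> _.
Qed.

Lemma Rintegral_cst_probability (r : R) : \int[P]_x r = r.
Proof.
rewrite Rintegral_cst// -[RHS]mulr1 -[in RHS](_ : fine (1%E : \bar R) = 1)//.
by congr (_ * fine _); exact: probability_setT.
Qed.

Variable phi : T -> T.
Hypothesis mphi : measurable_fun setT phi.
Hypothesis phi_inv : forall A, measurable A -> P (phi @^-1` A) = P A.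

Lemma Rintegral_preserving (f : T -> R) (B : R) : measurable_fun setT f ->
  (forall x, `|f x| <= B) -> \int[P]_x f (phi x) = \int[P]_x f x.
Proof.
move=> mf fB; congr fine.
transitivity (\int[pushforward P phi]_y (f y)%:E)%E; last first.
  by apply: eq_measure_integral => A mA _; exact: phi_inv.
rewrite integral_pushforward//; first exact/measurable_EFinP.
rewrite preimage_setT.
apply: (@bounded_integrable (f \o phi) B) => [|x]; last exact: fB.
exact: measurableT_comp.
Qed.

Definition birkhoff_sum (g : T -> R) (n : nat) (x : T) : R :=
  \sum_(k < n) g (iter k phi x).

Lemma birkhoff_sumS g n x :
  birkhoff_sum g n.+1 x = g x + birkhoff_sum g n (phi x).
Proof.
rewrite /birkhoff_sum big_ord_recl; congr (_ + _).
by apply: eq_bigr => k _; rewrite lift0 iterSr.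
Qed.

(* [max (0, S_1, ..., S_n)] for the Birkhoff sums [S_k] of [g]. *)
Fixpoint max_birkhoff (g : T -> R) (n : nat) : T -> R :=
  if n is m.+1 then cst 0 \max (g \+ (max_birkhoff g m \o phi)) else cst 0.

Lemma max_birkhoffS g n x : max_birkhoff g n.+1 x =
  Num.max 0 (g x + max_birkhoff g n (phi x)).
Proof. by []. Qed.

Lemma max_birkhoff_ge0 g n x : 0 <= max_birkhoff g n x.
Proof. by case: n => //= n; rewrite le_max lexx. Qed.

Lemma max_birkhoff_ndS g n x : max_birkhoff g n x <= max_birkhoff g n.+1 x.
Proof.
elim: n x => [|n IHn] x; first by rewrite /= le_max lexx.
have := IHn (phi x); rewrite /= => le_n.
by rewrite ge_max le_max lexx /= le_max lerD2l le_n orbT.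
Qed.

Lemma max_birkhoff_nd g m n x : (m <= n)%N ->
  max_birkhoff g m x <= max_birkhoff g n x.
Proof.
move=> /subnK <-; elim: (n - m)%N => [//|k IHk].
by rewrite addSn; apply: le_trans IHk (max_birkhoff_ndS _ _ _).
Qed.

Lemma birkhoff_le_max g n x : birkhoff_sum g n x <= max_birkhoff g n x.
Proof.
elim: n x => [|n IHn] x; first by rewrite /birkhoff_sum big_ord0.
by rewrite birkhoff_sumS /= le_max lerD2l IHn orbT.
Qed.

Lemma measurable_max_birkhoff g n : measurable_fun setT g ->
  measurable_fun setT (max_birkhoff g n).
Proof.
move=> mg; elim: n => [|n IHn] /=; first exact: measurable_cst.
apply: measurable_maxr; first exact: measurable_cst.
by apply: measurable_funD => //; exact: measurableT_comp.
Qed.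

Lemma max_birkhoff_bound g (B : R) n x : (forall y, `|g y| <= B) ->
  `|max_birkhoff g n x| <= B *+ n.
Proof.
move=> gB; have B0 : 0 <= B by exact: le_trans (normr_ge0 _) (gB x).
rewrite ger0_norm ?max_birkhoff_ge0//.
elim: n x => [//|n IHn] x; rewrite /= ge_max mulrn_wge0//= mulrS.
by apply: lerD => //; exact: le_trans (ler_norm _) (gB x).
Qed.

(** Garsia's argument: [M n - M n \o phi] is at most [g] on the event [E n] that [M n] is positive,
    and at most 0 off it. This difference integrates to 0, so [g] has nonnegative integral over
    [E n], and the events [E n] exhaust almost all of the space. *)
Lemma maximal_ergodic (g : T -> R) (B : R) : measurable_fun setT g ->
  (forall x, `|g x| <= B) ->
  {ae P, forall x, exists n, 0 < birkhoff_sum g n x} ->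
  0 <= \int[P]_x g x.
Proof.
move=> mg gB pos_ae.
pose M := max_birkhoff g.
pose E n := [set x | 0 < M n x].
have mM n : measurable_fun setT (M n) by exact: measurable_max_birkhoff.
have mE n : measurable (E n).
  have mlt : measurable_fun setT (fun x => cst 0 x < M n x).
    by apply: measurable_fun_ltr => //; exact: measurable_cst.
  by rewrite -[E n]setTI; apply: (mlt measurableT [set true]).
pose u n x := g x * \1_(E n) x.
have mu_ n : measurable_fun setT (u n).
  by apply: measurable_funM => //; exact: measurable_indic.
have uB n x : `|u n x| <= B.
  rewrite normrM; apply: le_trans (gB x).
  rewrite ler_piMr// indicE; case: (_ \in _); rewrite ?normr1 ?normr0 ?ler01//.
have B0 : 0 <= B by exact: le_trans (normr_ge0 _) (gB point).
have ge0 n : 0 <= \int[P]_x u n x.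
  have iM : P.-integrable setT (EFin \o M n).
    apply: (@bounded_integrable _ (B *+ n)) => // x.
    exact: max_birkhoff_bound.
  have iMp : P.-integrable setT (EFin \o (M n \o phi)).
    apply: (@bounded_integrable _ (B *+ n)) => [|x].
      exact: measurableT_comp.
    exact: max_birkhoff_bound.
  have <- : \int[P]_x (M n x - M n (phi x)) = 0.
    rewrite RintegralB// (@Rintegral_preserving _ (B *+ n))// ?subrr// => x.
    exact: max_birkhoff_bound.
  apply: le_Rintegral => //.
  - apply: (@bounded_integrable (fun x => M n x - M n (phi x))
      (B *+ n + B *+ n)).
      by apply: measurable_funB => //; exact: measurableT_comp.
    move=> x; apply: le_trans (ler_normB _ _) _.
    by apply: lerD; exact: max_birkhoff_bound.
  - exact: (@bounded_integrable _ B).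
  move=> x _; rewrite /u indicE; case: (boolP (x \in E n)) => /=.
    rewrite inE /E /= mulr1.
    (* [E 0] is empty. For a successor index the positive maximum is its second argument, and
       raising the index of the maximum at [phi x] only enlarges the right side. *)
    rewrite lerBlDr /M; case: n {iM iMp} => [|n]; first by rewrite /= ltxx.
    rewrite [max_birkhoff g n.+1 x]max_birkhoffS lt_max ltxx /= => pos.
    by rewrite (max_r (ltW pos)) lerD2l; exact: max_birkhoff_ndS.
  move=> /negP; rewrite inE /E /= => /negP; rewrite -leNgt mulr0 => M0.
  by rewrite subr_le0 (le_trans M0)// max_birkhoff_ge0.
have cvg_u : {ae P, forall x, setT x ->
    (fun n => (u n x)%:E) @ \oo --> (g x)%:E}.
  apply: filterS pos_ae => x [n0 pos0] _.
  (* Once [x] is in [E n0] it stays in all later events, so [u n x] is eventually equal to [g x]. *)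
  apply: cvg_near_cst; exists n0 => // n /= le_n.
  rewrite /u indicE mem_set ?mulr1// /E /=.
  apply: lt_le_trans pos0 _; apply: le_trans (birkhoff_le_max _ _ _) _.
  exact: max_birkhoff_nd.
have iB : P.-integrable setT (EFin \o cst B).
  apply: (@bounded_integrable _ B) => [|x]; first exact: measurable_cst.
  by rewrite /= ger0_norm.
have [_ _ cvgI] := @dominated_convergence _ T R P setT measurableT
  (fun n => EFin \o u n) (EFin \o g) (EFin \o cst B)
  (fun n => (measurable_EFinP _ _).2 (mu_ n))
  ((measurable_EFinP _ _).2 mg) cvg_u iB (aeW _ (fun x n _ => uB n x)).
have fin_g : (\int[P]_x (g x)%:E)%E \is a fin_num.
  by apply: integrable_fin_num => //; exact: (@bounded_integrable g B).
rewrite -lee_fin /Rintegral fineK//.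
apply: (cvge_to_ge cvgI); apply: nearW => n /=.
rewrite -[leRHS]fineK ?lee_fin; first exact: ge0.
by apply: integrable_fin_num => //; exact: (@bounded_integrable (u n) B).
Qed.
End MaximalErgodic.

Arguments birkhoff_sum {d T R} phi g n x.

(** * Height functions as potentials *)

Definition ilabel (w : config) (e : edge) : int := (label w e : nat)%:Z.

Lemma vaddE (x y i j : int) : ((x, y) : vertex) + (i, j) = (x + i, y + j).
Proof. by []. Qed.

Definition is_potential (w : config) (G : vertex -> int) : Prop :=
  forall z, G (z + (1, 0)) = G z + ilabel w (hedge z) /\
            G (z + (0, 1)) = G z + ilabel w (vedge z).

(** This local form stands in for the cocycle property: it holds almost surely, is preserved by
    translations, and is a countable system of equations, hence measurable. *)
Definition regular : set config := [set w | is_potential w (height w)].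

Definition step_sum (w : config) (x y : vertex) : int :=
  oapp (ilabel w) 0 (fwd_edge x y) - oapp (ilabel w) 0 (fwd_edge y x).

Lemma step_sumN w x y : step_sum w x y = - step_sum w y x.
Proof. by rewrite /step_sum opprB. Qed.

Lemma step_sum_right w z : step_sum w z (z + (1, 0)) = ilabel w (hedge z).
Proof.
rewrite /step_sum /fwd_edge eqxx.
case: eqP => [/eqP|_]; first by rewrite -addrA -subr_eq0 opprD addrA subrr.
case: eqP => [/eqP|_]; first by rewrite -addrA -subr_eq0 opprD addrA subrr.
by rewrite subr0.
Qed.

Lemma step_sum_up w z : step_sum w z (z + (0, 1)) = ilabel w (vedge z).
Proof.
rewrite /step_sum /fwd_edge eqxx.
case: eqP => [/eqP|_].
  by rewrite -subr_eq0 opprD addrA -(addrC (0, 1)) addrK.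
case: eqP => [/eqP|_]; first by rewrite -addrA -subr_eq0 opprD addrA subrr.
case: eqP => [/eqP|_]; first by rewrite -addrA -subr_eq0 opprD addrA subrr.
by rewrite subr0.
Qed.

Lemma adjacentP x y : Defs.adjacent x y ->
  [\/ y = x + (1, 0), y = x + (0, 1), x = y + (1, 0) | x = y + (0, 1)].
Proof.
rewrite /Defs.adjacent /fwd_edge.
by do 4 ?case: eqP => [-> _|_] //=;
  do ?[exact: Or41|exact: Or42|exact: Or43|exact: Or44].
Qed.

Lemma adjacent_neq x y : Defs.adjacent x y -> x != y.
Proof.
have ne (z c : vertex) : c != 0 -> z != z + c.
  by apply: contra => /eqP zc; rewrite -(inj_eq (addrI z)) addr0 -zc.
by case/adjacentP => ->; rewrite ?ne// eq_sym ne.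
Qed.

Lemma step_sum_potential w G x y : is_potential w G -> Defs.adjacent x y ->
  step_sum w x y = G y - G x.
Proof.
move=> wG; case/adjacentP => ->; rewrite ?[step_sum w (_ + _) _]step_sumN;
  rewrite ?step_sum_right ?step_sum_up ?(wG _).1 ?(wG _).2; lia.
Qed.

Lemma label_sum_cons w x y p :
  label_sum w x (y :: p) = step_sum w x y + label_sum w y p.
Proof.
rewrite /label_sum /pos_edges /neg_edges /step_sum /=.
by case: (fwd_edge x y) => [?|]; case: (fwd_edge y x) => [?|] /=;
  rewrite ?big_cons /ilabel; lia.
Qed.

Lemma label_sum_nil w x : label_sum w x [::] = 0.
Proof. by rewrite /label_sum !big_nil. Qed.

Lemma label_sum_cat w x p q :
  label_sum w x (p ++ q) = label_sum w x p + label_sum w (last x p) q.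
Proof.
elim: p x => [|y p IHp] x; first by rewrite label_sum_nil add0r.
by rewrite cat_cons !label_sum_cons IHp addrA.
Qed.

Lemma label_sum_potential w G x p :
  is_potential w G -> path Defs.adjacent x p ->
  label_sum w x p = G (last x p) - G x.
Proof.
move=> wG; elim: p x => [|y p IHp] x /=; first by rewrite label_sum_nil subrr.
case/andP => xy yp; rewrite label_sum_cons (step_sum_potential _ _ _ _ wG xy).
by rewrite IHp //; lia.
Qed.

(** The label sum telescopes along the path chosen in [height]. Heights can thus be computed from
    any potential, without naming a path. *)
Lemma height_potential w G z : is_potential w G -> height w z = G z - G 0.
Proof.
move=> wG; rewrite /height.
have /and3P[zp _ /eqP lp] : sapath 0 z (xget [::] [set p | sapath 0 z p]).
  by apply: (@xgetPex _ [::] [set p | sapath 0 z p]); exact: sapath_exists.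
by rewrite (label_sum_potential _ _ _ _ wG) // lp.
Qed.

Lemma potential_regular w G : is_potential w G -> regular w.
Proof.
move=> wG z; rewrite !(height_potential _ _ _ wG).
by rewrite (wG z).1 (wG z).2; split; lia.
Qed.

Lemma height0 w : regular w -> height w 0 = 0.
Proof. by move=> rw; rewrite (height_potential _ _ _ rw) subrr. Qed.

(* A self-avoiding path from 0 to [x] either extends to [y] or already visits
   [y]; in the latter case its tail is compared with the single edge from [y]
   to [x]. *)
Lemma height_step w x y : cocycle_property w -> Defs.adjacent x y ->
  height w y = height w x + step_sum w x y.
Proof.
move=> cw xy; have [p xp] := sapath_exists x.
rewrite (heightE cw xp); move: xp => /and3P[px up /eqP lp].
case: (boolP (y \in 0 :: p)) => [yp|yp]; last first.
  have yrp : sapath 0 y (rcons p y).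
    by rewrite /sapath rcons_path px lp xy -rcons_cons rcons_uniq yp up
      last_rcons eqxx.
  by rewrite (heightE cw yrp) -cats1 label_sum_cat lp label_sum_cons
    label_sum_nil addr0.
case: (splitPl yp) px up lp => p1 p2 ly.
rewrite cat_path -cat_cons cat_uniq last_cat ly.
move=> /andP[pp1 pp2] /and3P[up1 dis up2] lp.
have yp1 : sapath 0 y p1 by rewrite /sapath pp1 up1 ly eqxx.
have yp2 : sapath y x p2.
  rewrite /sapath pp2 lp eqxx /= up2 !andbT.
  apply: contra dis => yp2; apply/hasP; exists y => //.
  by rewrite -ly mem_last.
have yx1 : sapath y x [:: x].
  rewrite /sapath /= !andbT inE eqxx andbT eq_sym (adjacent_neq _ _ xy) andbT.
  by rewrite /Defs.adjacent orbC.
rewrite (heightE cw yp1) label_sum_cat ly.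
have := (cw _ _ _ _ yp2 yx1).1; rewrite -!label_sumE label_sum_cons.
by rewrite label_sum_nil (step_sumN w y x) => ->; lia.
Qed.

Lemma cocycle_regular w : cocycle_property w -> regular w.
Proof.
move=> cw z; split.
  rewrite (height_step _ z)// ?step_sum_right//.
  by rewrite /Defs.adjacent /fwd_edge eqxx.
rewrite (height_step _ z)// ?step_sum_up//.
by rewrite /Defs.adjacent /fwd_edge eqxx; case: ifP.
Qed.

Lemma potential_translate a w G :
  is_potential w G -> is_potential (translate a w) (fun z => G (z + a)).
Proof.
move=> wG z; rewrite ![z + _ + a]addrAC (wG (z + a)).1 (wG (z + a)).2.
by split.
Qed.

Lemma regular_translate a w : regular w -> regular (translate a w).
Proof. by move=> /(potential_translate a)/potential_regular. Qed.

(** Translating the configuration shifts its potential by [a]; normalising the shifted potential at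
    0 subtracts [height w a]. *)
Lemma height_translate a w z : regular w ->
  height (translate a w) z = height w (z + a) - height w a.
Proof.
move=> /(potential_translate a) wa.
by rewrite (height_potential _ _ _ wa) add0r.
Qed.

Lemma translate_comp a b w : translate a (translate b w) = translate (a + b) w.
Proof. by rewrite /translate; apply/funext => e /=; rewrite addrA. Qed.

Lemma translate0 w : translate 0 w = w.
Proof. by apply/funext => -[z b]; rewrite /translate /= addr0. Qed.

Lemma unit_steps_lipschitz (u : int -> int) (i : int) :
  (forall k, `|u (k + 1) - u k| <= 1) -> `|u i - u 0| <= `|i|.
Proof.
move=> u1; elim/int_rect: i => [|n IHn|n IHn]; first by rewrite subrr.
  have := u1 n%:Z; rewrite -PoszD addn1.
  by move: IHn; move: (u n.+1%:Z) (u n%:Z) (u 0) => a b c; lia.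
have := u1 (- n.+1%:Z); rewrite (_ : - n.+1%:Z + 1 = - n%:Z); last by lia.
by move: IHn; move: (u (- n.+1%:Z)) (u (- n%:Z)) (u 0) => a b c; lia.
Qed.

(** Go from [z] to [z + c] horizontally, then vertically: up to sign, each unit step changes [G] by
    a label, which is 0 or 1. *)
Lemma potential_lipschitz w (G : vertex -> int) (z c : vertex) :
  is_potential w G ->
  `|G (z + c) - G z| <= `|c.1| + `|c.2|.
Proof.
move=> wG.
have lab e : 0 <= ilabel w e <= 1 by rewrite /ilabel; case: (label w e).
have right (x y : int) : `|G ((x + 1, y)) - G (x, y)| <= 1.
  have := (wG (x, y)).1; rewrite vaddE addr0 => ->.
  by have := lab (hedge (x, y)); lia.
have up (x y : int) : `|G ((x, y + 1)) - G (x, y)| <= 1.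
  have := (wG (x, y)).2; rewrite vaddE addr0 => ->.
  by have := lab (vedge (x, y)); lia.
case: z c => [x y] [i j]; rewrite vaddE /=.
have := unit_steps_lipschitz (fun k => G (x + k, y)) i.
have := unit_steps_lipschitz (fun k => G (x + i, y + k)) j.
rewrite /= !addr0 => ups rights.
apply: le_trans (ler_distD (G (x + i, y)) _ _) _.
rewrite addrC; apply: lerD.
  by apply: rights => k; rewrite addrA.
by apply: ups => k; rewrite addrA.
Qed.

(** * Measurability and mean of the height *)

Lemma measurable_label e :
  measurable_fun [set: config] (fun w => label w e).
Proof.
move=> _ Y mY; apply: sub_sigma_algebra; exists e => //.
by exists Y => //; rewrite !setTI.
Qed.

Lemma measurable_translate a : measurable_fun [set: config] (translate a).
Proof.
apply: (@measurability _ _ config config _ _ cylinders) => //.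
move=> _ [_ [e _ [Y mY <-]] <-].
have := @measurable_label (e.1 + a, e.2) measurableT Y mY.
by rewrite !setTI.
Qed.

Lemma step_sum_bound w x y : `|step_sum w x y| <= 1.
Proof.
have lab o : 0 <= oapp (ilabel w) 0 o <= 1.
  by case: o => //= e; rewrite /ilabel; case: (label w e).
have := lab (fwd_edge x y); have := lab (fwd_edge y x).
by rewrite /step_sum; move: (oapp _ _ _) (oapp _ _ _) => i j; lia.
Qed.

Lemma label_sum_bound w x p : `|label_sum w x p| <= (size p)%:Z.
Proof.
elim: p x => [|y p IHp] x; first by rewrite label_sum_nil.
rewrite label_sum_cons /= -add1n PoszD; apply: le_trans (ler_normD _ _) _.
by apply: lerD => //; exact: step_sum_bound.
Qed.

Section HeightProcess.
Context (R : realType).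

Definition rheight (z : vertex) (w : config) : R := (height w z)%:~R.

(** The path chosen in [height] is common to all configurations, so its length is a uniform
    bound. *)
Lemma rheight_bound z : exists B : R, forall w, `|rheight z w| <= B.
Proof.
exists (size (xget [::] [set p | sapath 0 z p]))%:R => w.
by rewrite /rheight -intr_norm [leRHS]pmulrn ler_int label_sum_bound.
Qed.

Lemma measurable_ilabel e :
  measurable_fun [set: config] (fun w => (ilabel w e)%:~R : R).
Proof.
rewrite (_ : (fun _ => _) = (fun w => if label w e then 1 else 0 : R)).
  by apply: measurable_fun_ifT => //; exact: measurable_label.
by apply/funext => w; rewrite /ilabel; case: (label w e).
Qed.

Lemma measurable_rheight z : measurable_fun setT (rheight z).
Proof.
pose p := xget [::] [set p | sapath 0 z p].
rewrite (_ : rheight z = fun w =>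
    \sum_(e <- pos_edges 0 p) (ilabel w e)%:~R -
    \sum_(e <- neg_edges 0 p) (ilabel w e)%:~R); last first.
  by apply/funext => w; rewrite -!(rmorph_sum _ _ _ (ilabel w)) -rmorphB.
by apply: measurable_funB; apply: measurable_sum => e; exact: measurable_ilabel.
Qed.

Lemma measurable_regular : measurable regular.
Proof.
have mE z c e : measurable
    [set w : config | height w (z + c) = height w z + ilabel w e].
  have mb : measurable_fun [set: config]
      (fun w => rheight (z + c) w == rheight z w + (ilabel w e)%:~R).
    apply: measurable_fun_eqr; first exact: measurable_rheight.
    by apply: measurable_funD; [exact: measurable_rheight|
      exact: measurable_ilabel].
  rewrite (_ : [set _ | _] =
    setT `&` (fun w => rheight (z + c) w == rheight z w + (ilabel w e)%:~R)
      @^-1` [set true]); first exact: mb.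
  rewrite setTI; apply/seteqP; split => w /=.
    by rewrite /rheight => ->; rewrite rmorphD /= eqxx.
  by rewrite /rheight -intrD => /eqP/intr_inj.
(* Vertices are enumerated by their codes, which makes the intersection countable; a number that
   codes no vertex imposes nothing. *)
rewrite (_ : regular = \bigcap_(n in setT)
    if (unpickle n : option vertex) is Some z then
      [set w | height w (z + (1, 0)) = height w z + ilabel w (hedge z)] `&`
      [set w | height w (z + (0, 1)) = height w z + ilabel w (vedge z)]
    else setT).
  apply: bigcapT_measurable => n; case: (unpickle n) => [z|] //.
  exact: measurableI.
apply/seteqP; split => w /=.
  by move=> rw n _; case: (unpickle n) => [z|] //=; case: (rw z).
by move=> rw z; have := rw (pickle z) I; rewrite pickleK.
Qed.

(** By [height_translate], the sum after its first term is the height at [(n+1) z] minus the height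
    at [z]. Growth along a ray thereby becomes an ergodic average. *)
Lemma birkhoff_height z w n : regular w ->
  birkhoff_sum (translate z) (rheight z) n w = rheight (z *+ n) w.
Proof.
elim: n w => [|n IHn] w rw.
  by rewrite /birkhoff_sum big_ord0 /rheight mulr0n height0.
rewrite birkhoff_sumS IHn; last exact: regular_translate.
by rewrite /rheight height_translate// mulrSr -intrD addrC subrK.
Qed.

End HeightProcess.

Section CocycleMeasure.
Context (R : realType) (mu : probability config R).
Hypothesis mu_cocycle : cocycle_measure mu.
Hypothesis mu_stationary : stationary mu.

Definition mean_height (z : vertex) : R :=
  mean_h mu * z.1%:~R + mean_v mu * z.2%:~R.

Lemma ae_regular : {ae mu, forall w, regular w}.
Proof. by apply: filterS mu_cocycle => w; exact: cocycle_regular. Qed.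

Let ilabel_bound (e : edge) (w : config) : `|(ilabel w e)%:~R : R| <= 1.
Proof. by rewrite /ilabel; case: (label w e); rewrite /= ?normr1 ?normr0. Qed.

Lemma Rintegral_ilabel z b :
  \int[mu]_w (ilabel w (z, b))%:~R = \int[mu]_w ((ilabel w (0, b))%:~R : R).
Proof.
rewrite -(@Rintegral_preserving _ _ _ mu (translate z)
  (measurable_translate z) (mu_stationary z) _ 1
  (measurable_ilabel R (0, b)) (ilabel_bound (0, b))).
by apply: eq_Rintegral => w _; rewrite /ilabel /label /translate /= add0r.
Qed.

Lemma mean_hE z : \int[mu]_w (ilabel w (hedge z))%:~R = mean_h mu.
Proof.
by rewrite Rintegral_ilabel /mean_h unlock.
Qed.

Lemma mean_vE z : \int[mu]_w (ilabel w (vedge z))%:~R = mean_v mu.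
Proof.
by rewrite Rintegral_ilabel /mean_v unlock.
Qed.

Lemma Rintegral_rheight_step z c e :
  (forall w, regular w -> height w (z + c) = height w z + ilabel w e) ->
  \int[mu]_w rheight R (z + c) w =
  \int[mu]_w rheight R z w + \int[mu]_w (ilabel w e)%:~R.
Proof.
move=> step; have [B zB] := rheight_bound R z.
have mz := measurable_rheight R z; have me := measurable_ilabel R e.
rewrite -RintegralD//.
- apply: ae_eq_Rintegral; first exact: measurable_rheight.
    exact: measurable_funD.
  by apply: filterS ae_regular => w /step; rewrite /rheight => ->;
    rewrite intrD.
- exact: (bounded_integrable _ _ _ _ _ _ mz zB).
- exact: (bounded_integrable _ _ _ _ _ _ me (ilabel_bound e)).
Qed.

Lemma int_affine (u : int -> R) a i :
  (forall k, u (k + 1) = u k + a) -> u i = u 0 + a * i%:~R.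
Proof.
move=> ua; elim/int_rect: i => [|n IHn|n IHn]; first by rewrite mulr0 addr0.
  by rewrite -addn1 PoszD ua IHn intrD mulrDr mulr1 addrA.
apply: (addIr a); rewrite -ua (_ : - n.+1%:Z + 1 = - n%:Z); last by lia.
rewrite IHn (_ : - n%:Z = - n.+1%:Z + 1); last by lia.
by rewrite intrD; ring.
Qed.

(** The mean is 0 at the origin, and by stationarity every unit step adds [mean_h mu] or
    [mean_v mu]; follow the horizontal axis, then a vertical line. *)
Lemma Rintegral_rheight z : \int[mu]_w rheight R z w = mean_height z.
Proof.
pose m z := \int[mu]_w rheight R z w.
have m0 : m 0 = 0.
  rewrite /m (@ae_eq_Rintegral _ _ _ _ _ (cst 0)).
  - exact: Rintegral_cst_probability.
  - exact: measurable_rheight.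
  - exact: measurable_cst.
  - by apply: filterS ae_regular => w /height0; rewrite /rheight => ->.
case: z => x y; rewrite -/(m (x, y)) /mean_height /=.
have mx k : m (k + 1, 0) = m (k, 0) + mean_h mu.
  rewrite (_ : (k + 1, 0) = (k, 0) + (1, 0)); last by rewrite vaddE addr0.
  rewrite -(mean_hE (k, 0)); apply: Rintegral_rheight_step => w rw.
  exact: (rw _).1.
have my k : m (x, k + 1) = m (x, k) + mean_v mu.
  rewrite (_ : (x, k + 1) = (x, k) + (0, 1)); last by rewrite vaddE addr0.
  rewrite -(mean_vE (x, k)); apply: Rintegral_rheight_step => w rw.
  exact: (rw _).2.
rewrite (int_affine (fun k => m (x, k)) _ _ my).
by rewrite (int_affine (fun k => m (k, 0)) _ _ mx) m0 add0r.
Qed.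

End CocycleMeasure.

(** * Linear growth along rays and in the plane *)

Lemma vmulrnE (x y : int) n : ((x, y) : vertex) *+ n = (x *+ n, y *+ n).
Proof. by elim: n => // n IHn; rewrite !mulrS IHn. Qed.

Section LinearGrowth.
Context (R : realType) (G : vertex -> int) (h v : R).
Hypothesis h01 : 0 < h < 1.
Hypothesis v01 : 0 < v < 1.
Hypothesis lipG : forall z c : vertex, `|G (z + c) - G z| <= `|c.1| + `|c.2|.

Let L (z : vertex) : R := h * z.1%:~R + v * z.2%:~R.

(** An error of [n] is enough: base points will range over a box of radius [K], and against
    distances of order [K * n] the relative error is of order [1/K]. *)
Hypothesis rayG : forall z, exists N, forall n, (N <= n)%N ->
  `|(G (z *+ n))%:~R - n%:R * L z| <= n%:R.

Let LD z c : L (z + c) = L z + L c.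
Proof. by rewrite /L /= !rmorphD /=; ring. Qed.

Let LMn z n : L (z *+ n) = n%:R * L z.
Proof.
elim: n => [|n IHn]; first by rewrite mul0r /L /= !mulr0 addr0.
by rewrite mulrS LD IHn mulrSr mulrDl mul1r addrC.
Qed.

(* Each [z] in the box of radius [K n] is within [2 n] of [n z0] for one of
   finitely many [z0]. *)
Lemma growth_uniform (K : nat) : exists N, forall (n : nat) (x y : int),
  (N <= n)%N -> `|x| <= (K * n)%:Z -> `|y| <= (K * n)%:Z ->
  `|(G (x, y))%:~R - L (x, y)| <= 5 * n%:R.
Proof.
have [N rayN] := choice rayG.
pose box (i j : 'I_(2 * K).+1) : vertex := (i%:Z - K%:Z, j%:Z - K%:Z).
(* The largest threshold over the finite box; the successor makes [n] positive, so that one can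
   divide by it. *)
exists (\max_i \max_j N (box i j)).+1 => n x y leN xK yK.
have n0 : (0 < n)%N by exact: leq_ltn_trans leN.
have quot (t : int) : `|t| <= (K * n)%:Z ->
    exists (i : 'I_(2 * K).+1) (r : nat),
      (r < n)%N /\ t = (i%:Z - K%:Z) *+ n + r%:Z.
  move=> tK; have tE := divz_eq t n%:Z.
  have r0 : 0 <= (t %% n%:Z)%Z by apply: modz_ge0; lia.
  have rn : (t %% n%:Z)%Z < n%:Z by apply: ltz_pmod; lia.
  (* The remainder is nonnegative even when [t] is negative, so the quotient lies between [-K] and
     [K]. *)
  have [q0 qK] : 0 <= (t %/ n%:Z)%Z + K%:Z /\ (t %/ n%:Z)%Z <= K%:Z.
    by move: (t %/ n%:Z)%Z (t %% n%:Z)%Z tE r0 rn => q r tE r0 rn; split; nia.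
  have iK : (absz ((t %/ n%:Z)%Z + K%:Z)%R < (2 * K).+1)%N by lia.
  exists (Ordinal iK), (absz (t %% n%:Z)%Z); split; first by lia.
  by rewrite /= -mulr_natr !gez0_abs// natz addrK.
have [i [r [rn ->]]] := quot x xK; have [j [s [sn ->]]] := quot y yK.
rewrite -vaddE -vmulrnE -/(box i j).
have leNz : (N (box i j) <= n)%N.
  apply: leq_trans (ltnW leN); apply: leq_trans (leq_bigmax i).
  exact: (leq_bigmax j).
have ray := rayN _ _ leNz.
have lip : `|(G (box i j *+ n + (r%:Z, s%:Z)))%:~R - (G (box i j *+ n))%:~R|
    <= r%:R + s%:R :> R.
  by rewrite -rmorphB -intr_norm -natrD [leRHS]pmulrn ler_int PoszD lipG.
have -> : L (box i j *+ n + (r%:Z, s%:Z)) =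
    n%:R * L (box i j) + (h * r%:R + v * s%:R).
  by rewrite LD LMn.
have part (a : R) (k : nat) : 0 < a < 1 -> (k < n)%N ->
    0 <= a * k%:R <= n%:R /\ k%:R <= n%:R :> R.
  move=> /andP[a0 a1] kn; have kn' : k%:R <= n%:R :> R by rewrite ler_nat ltnW.
  have k0 : 0 <= k%:R :> R by [].
  by split=> //; apply/andP; split; nra.
have [/andP[hr0 hrn] rn'] := part h r h01 rn.
have [/andP[vs0 vsn] sn'] := part v s v01 sn.
(* The constant 5 is 1 from the ray estimate, 2 from the Lipschitz bound on [G] and 2 from the
   change [h r + v s] of [L]. *)
move: ray lip; rewrite !ler_norml => /andP[? ?] /andP[? ?].
by apply/andP; split; lra.
Qed.

(** The first condition makes [|L z|] at least a fixed multiple of [|z|]. At a zero of [G], the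
    uniform estimate with [n] close to [|z| / K] gives [|L z| <= 5 n], which for large [K] is too
    small unless [z] lies in a bounded box. *)
Lemma growth_zeros_finite (eps : R) : 0 < eps ->
  finite_set [set z : vertex | v * eps * `|z.1%:~R| <= `|L z| /\ G z = 0].
Proof.
move=> eps0; have /andP[h0 h1] := h01; have /andP[v0 v1] := v01.
(* Obtained from [v |y| <= |L z| + h |x|] and [|x| <= |L z| / (v eps)]. *)
pose C : R := v^-1 * (1 + (v + h) / (v * eps)).
have C0 : 0 < C.
  by rewrite mulr_gt0 ?invr_gt0// addr_gt0// divr_gt0 ?mulr_gt0 ?addr_gt0.
have normC z : v * eps * `|z.1%:~R| <= `|L z| ->
    `|z.1%:~R| + `|z.2%:~R| <= C * `|L z|.
  move=> zL.
  have y_le : v * `|z.2%:~R| <= `|L z| + h * `|z.1%:~R|.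
    have -> : v * `|z.2%:~R| = `|L z - h * z.1%:~R|.
      by rewrite /L addrAC subrr add0r normrM (gtr0_norm v0).
    have -> : h * `|z.1%:~R| = `|h * z.1%:~R| by rewrite normrM (gtr0_norm h0).
    exact: ler_normB.
  have x_le : `|z.1%:~R| <= `|L z| / (v * eps).
    by rewrite ler_pdivlMr ?mulr_gt0// mulrC.
  rewrite /C -mulrA mulrC ler_pdivlMr// mulrDl mulrDl mul1r.
  apply: le_trans (_ : `|L z| + (v + h) * (`|L z| / (v * eps)) <= _).
    have : (v + h) * `|z.1%:~R| <= (v + h) * (`|L z| / (v * eps)).
      by rewrite ler_pM2l// addr_gt0.
    by lra.
  by rewrite -!mulrA (mulrC `|L z|).
(* The final contradiction is with [K (n - 1) <= 5 C n]; [K > 10 C] and [n >= 3] exclude it. *)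
pose K := (Num.truncn (10 * C)).+1.
have KC : 10 * C < K%:R by exact: truncnS_gt.
have [N unif] := growth_uniform K.
(* If [|x| + |y|] is at least this, the quotient by [K] is at least [N] and 2, so its successor [n]
   is an admissible scale with [n >= 3]. *)
pose B := (K * maxn N 2)%N.
pose shift (ij : 'I_B.*2.+1 * 'I_B.*2.+1) : vertex :=
  (ij.1%:Z - B%:Z, ij.2%:Z - B%:Z).
have ibox : finite_set (shift @` setT) by exact/finite_image/finite_finset.
apply: sub_finite_set ibox => -[x y] [/= zL Gz].
suff small : (absz x + absz y < B)%N.
  have xB : (absz (x + B%:Z)%R < B.*2.+1)%N by lia.
  have yB : (absz (y + B%:Z)%R < B.*2.+1)%N by lia.
  by exists (Ordinal xB, Ordinal yB); rewrite // /shift /=; congr (_, _); lia.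
rewrite ltnNge; apply/negP => leB.
set M := (absz x + absz y)%N in leB.
pose n := (M %/ K).+1.
have nN : (N < n)%N /\ (2 < n)%N.
  have : (maxn N 2 <= M %/ K)%N by rewrite leq_divRL// mulnC.
  by rewrite /n geq_max => /andP[? ?]; split.
have Mn : (M < K * n)%N by rewrite mulnC; exact: ltn_ceil.
have nM : (K * n.-1 <= M)%N by rewrite mulnC; exact: leq_trunc_div.
have := unif n x y (ltnW nN.1).
rewrite Gz /= sub0r normrN => /(_ _ _)/wrap[||Ln]; [lia|lia|].
have := normC (x, y) zL; rewrite /= => MC.
have MR : `|x%:~R| + `|y%:~R| = M%:R :> R.
  by rewrite /M natrD !natr_absz !intr_norm.
have : K%:R * n.-1%:R <= C * (5 * n%:R) :> R.
  rewrite -natrM; apply: le_trans (_ : M%:R <= _); first by rewrite ler_nat.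
  by rewrite -MR; apply: le_trans MC _; rewrite ler_pM2l.
have n3 : 3 <= n%:R :> R by rewrite ler_nat nN.2.
have -> : n.-1%:R = n%:R - 1 :> R by rewrite /n -natr1 addrK.
nra.
Qed.

End LinearGrowth.

(** * Growth of the height of an ergodic cocycle measure *)

Section ErgodicGrowth.
Context (R : realType) (mu : probability config R).
Hypothesis mu_cocycle : cocycle_measure mu.
Hypothesis mu_stationary : stationary mu.
Hypothesis mu_ergodic : ergodic mu.

(* [limsup_n s f(n z) / n >= a], as a countable combination of events; the
   slack [1/(k+1)] absorbs the bounded change of [f] under a translation. *)
Let limsup_ge (s a : R) (z : vertex) : set config := regular `&`
  \bigcap_k \bigcap_N \bigcup_(n in [set n | (N <= n)%N])
    [set w | (a - k.+1%:R^-1) * n%:R < s * rheight R (z *+ n) w].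

Let measurable_limsup_ge s a z : measurable (limsup_ge s a z).
Proof.
apply: measurableI; first exact: measurable_regular R.
apply: bigcapT_measurable => k; apply: bigcapT_measurable => N.
apply: bigcup_measurable => n _.
have mlt : measurable_fun [set: config]
    (fun w => cst ((a - k.+1%:R^-1) * n%:R) w < s * rheight R (z *+ n) w).
  apply: measurable_fun_ltr; first exact: measurable_cst.
  by apply: measurable_funM; [exact: measurable_cst|exact: measurable_rheight].
by rewrite -[X in measurable X]setTI; apply: (mlt measurableT [set true]).
Qed.

Lemma rheight_translate_lipschitz (c z : vertex) w : regular w ->
  `|rheight R z (translate c w) - rheight R z w| <=
  2 * (`|c.1|%:~R + `|c.2|%:~R).
Proof.
move=> rw; rewrite /rheight height_translate// -!rmorphB -intr_norm -intrD.
rewrite -(intrM _ 2) ler_int.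
have := potential_lipschitz w (height w) z c rw.
have := potential_lipschitz w (height w) 0 c rw.
rewrite add0r height0//.
move: (height w (z + c)) (height w z) (height w c) => i j k; lia.
Qed.

Let limsup_ge_translate s a z c :
  limsup_ge s a z `<=` translate c @^-1` limsup_ge s a z.
Proof.
move=> w [rw wA]; split; first exact: regular_translate.
move=> k _ N _.
(* [D] bounds the change of [s f(n z)] under translation by [c], for all [n]; for [n >= m] it is at
   most [n / (2 (k + 1))]. *)
pose D : R := `|s| * (2 * (`|c.1|%:~R + `|c.2|%:~R)).
pose m := (Num.truncn (D * (2 * k.+1%:R))).+1.
(* Index [2 k + 1] uses half of the slack [1 / (k + 1)]; the other half pays for [D]. *)
have [n /= leN ltn] := wA (k.*2.+1) I (maxn N m) I.
move: leN; rewrite geq_max => /andP[Nn mn]; exists n => //=.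
have Dn : D * (2 * k.+1%:R) <= n%:R.
  by apply: le_trans (ltW (truncnS_gt _)) _; rewrite ler_nat.
have lip : s * rheight R (z *+ n) w - D <=
    s * rheight R (z *+ n) (translate c w).
  rewrite lerBlDr -lerBlDl -mulrBr; apply: le_trans (ler_norm _) _.
  rewrite normrM distrC ler_wpM2l//; exact: rheight_translate_lipschitz.
apply: lt_le_trans lip; rewrite ltrBrDr; apply: le_lt_trans ltn.
have k0 : 0 < k.+1%:R :> R by [].
have -> : k.*2.+2%:R = 2 * k.+1%:R :> R.
  by rewrite -doubleS -muln2 natrM mulrC.
rewrite -ler_pdivlMr in Dn; last by rewrite mulr_gt0.
apply: le_trans (_ : (a - k.+1%:R^-1) * n%:R + n%:R / (2 * k.+1%:R) <= _).
  by rewrite lerD2l.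
by rewrite le_eqVlt; apply/orP; left; apply/eqP; field; rewrite lt0r_neq0.
Qed.

Let limsup_ge_invariant s a z c :
  translate c @^-1` limsup_ge s a z = limsup_ge s a z.
Proof.
apply/seteqP; split; last exact: limsup_ge_translate.
move=> w /(limsup_ge_translate _ _ _ (- c)) /=.
by rewrite translate_comp addNr translate0.
Qed.

(** The event [limsup_ge s a z] is invariant under all translations, so it has probability 0 or 1.
    If 1, pick [b = a - 1/(k+1)] still above [s * mean_height R mu z]: almost surely some Birkhoff
    sum of [s f(z) - b] is positive, and the maximal inequality forces the mean to be at least [b],
    a contradiction. *)
Lemma ae_growth_le (s a : R) (z : vertex) : s * mean_height R mu z < a ->
  {ae mu, forall w, exists N, forall n, (N <= n)%N ->
    s * rheight R (z *+ n) w <= a * n%:R}.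
Proof.
move=> sa; set A := limsup_ge s a z.
have mA : measurable A by exact: measurable_limsup_ge.
suff A0 : mu A = 0%E.
  have nA : {ae mu, forall w, ~ A w} by exists A; split => // w /= /contrapT.
  (* A regular configuration exceeding [a * n] for arbitrarily large [n] also exceeds every lowered
     level there, hence lies in the null event. *)
  apply: filterS2 nA (ae_regular _ _ mu_cocycle) => w nAw rw.
  apply: contrapT => noN; apply: nAw; split => // k _ N _.
  apply: contrapT => nbig; apply: noN; exists N => n leN.
  rewrite leNgt; apply/negP => big; apply: nbig; exists n => //=.
  by apply: le_lt_trans big; rewrite ler_wpM2r// lerBlDr lerDl invr_ge0.
have [//|A1] := mu_ergodic _ mA (limsup_ge_invariant s a z).
have aeA : {ae mu, forall w, A w}.
  exists (~` A); split => //; first exact: measurableC.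
  by rewrite probability_setC// A1 subee.
have [k ak] := ltr_add_invr sa.
pose b := a - k.+1%:R^-1.
have [B zB] := rheight_bound R z.
have mz := measurable_rheight R z.
have msz : measurable_fun setT (fun w => s * rheight R z w).
  by apply: measurable_funM => //; exact: measurable_cst.
have mg : measurable_fun setT (fun w => s * rheight R z w - b).
  by apply: measurable_funB => //; exact: measurable_cst.
have szB w : `|s * rheight R z w| <= `|s| * B.
  by rewrite normrM ler_wpM2l.
have : 0 <= \int[mu]_w (s * rheight R z w - b).
  apply: (maximal_ergodic _ _ _ _ (translate z) (measurable_translate z)
    (mu_stationary z) _ (`|s| * B + `|b|)) => //.
    by move=> w; apply: le_trans (ler_normB _ _) _; rewrite lerD2r.
  apply: filterS aeA => w [rw wA].
  have [n /= n1 bn] := wA k I 1%N I; exists n.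
  have -> : birkhoff_sum (translate z) (fun w => s * rheight R z w - b) n w =
      s * birkhoff_sum (translate z) (rheight R z) n w - b * n%:R.
    by rewrite /birkhoff_sum sumrB -mulr_sumr sumr_const card_ord mulr_natr.
  by rewrite birkhoff_height// subr_gt0.
rewrite RintegralB//; first last.
- exact: (bounded_integrable _ _ _ _ (cst b) `|b|).
- exact: (bounded_integrable _ _ _ _ _ _ msz szB).
rewrite RintegralZl//; last exact: (bounded_integrable _ _ _ _ _ _ mz zB).
rewrite Rintegral_rheight// Rintegral_cst_probability subr_ge0.
by rewrite leNgt /b ltrBrDr ak.
Qed.

Lemma ae_ray_growth :
  {ae mu, forall w, forall z : vertex, exists N, forall n, (N <= n)%N ->
    `|rheight R (z *+ n) w - n%:R * mean_height R mu z| <= n%:R}.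
Proof.
suff rays z : {ae mu, forall w, exists N, forall n, (N <= n)%N ->
    `|rheight R (z *+ n) w - n%:R * mean_height R mu z| <= n%:R}.
  (* Passing to codes of vertices leaves a countable intersection of almost sure events. *)
  have : {ae mu, forall w, forall i (z : vertex), unpickle i = Some z ->
      exists N, forall n, (N <= n)%N ->
      `|rheight R (z *+ n) w - n%:R * mean_height R mu z| <= n%:R}.
    apply: ae_foralln => i; case: (unpickle i) => [z|].
      by apply: filterS (rays z) => w wz _ [<-].
    by apply: aeW => w z.
  by apply: filterS => w wz z; apply: (wz (pickle z)); rewrite pickleK.
set m := mean_height R mu z.
have up : 1 * m < m + 1 by rewrite mul1r ltrDl.
have dn : -1 * m < - m + 1 by rewrite mulN1r ltrDl.
(* The signs [s = 1] and [s = -1] give the upper and lower bounds, each with tolerance 1 per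
   step. *)
apply: filterS2 (ae_growth_le _ _ _ up) (ae_growth_le _ _ _ dn).
move=> w [N1 w1] [N2 w2]; exists (maxn N1 N2) => n.
rewrite geq_max => /andP[/w1 le1 /w2 le2]; rewrite ler_norml.
by apply/andP; split; lra.
Qed.

End ErgodicGrowth.

Theorem lemma2p3 (R : realType) (mu : probability config R)
  (mu_cocycle : cocycle_measure mu)
  (mu_stationary : stationary mu)
  (mu_ergodic : ergodic mu)
  (h01 : 0 < mean_h mu < 1)
  (v01 : 0 < mean_v mu < 1)
  (eps : R) (eps_gt0 : 0 < eps) :
  {ae mu, forall w : config,
    finite_set [set z : vertex | ~ C0 mu eps z /\ height w z = 0]}.
Proof.
apply: filterS2 (ae_regular _ _ mu_cocycle)
  (ae_ray_growth _ _ mu_cocycle mu_stationary mu_ergodic) => w rw rays.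
have lip z c := potential_lipschitz w (height w) z c rw.
apply: sub_finite_set
  (growth_zeros_finite R (height w) _ _ h01 v01 lip rays _ eps_gt0).
move=> z [/= nC0 fz]; split => //.
have /andP[v0 _] := v01.
(* Points of the vertical axis lie outside the cone; for them the required lower bound on [|L z|] is
   0. *)
have [->|z0] := eqVneq z.1 0; first by rewrite normr0 mulr0.
have z0R : z.1%:~R != 0 :> R by rewrite intr_eq0.
(* Since [alpha0 mu] is the slope of the line [L = 0], being outside the cone bounds the middle
   factor below by [eps]. *)
have -> : mean_h mu * z.1%:~R + mean_v mu * z.2%:~R =
    mean_v mu * (z.2%:~R / z.1%:~R - alpha0 mu) * z.1%:~R.
  by rewrite /alpha0; field; rewrite z0R lt0r_neq0.
rewrite !normrM ler_wpM2r// (gtr0_norm v0) ler_pM2l// leNgt; apply/negP.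
rewrite ltr_distl => /andP[/ltW lo /ltW hi]; apply: nC0.
by split => //; rewrite lo hi.
Qed.
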